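(* Let $k,m\ge 1$ be integers and let $n$ be an integer with $n-2>(\sqrt{m}+4)^{2k+3}$. Let $H$ be the graph obtained from the complete graph $K_n$ by removing one edge. Let $H_1,\dots,H_m$ be vertex-disjoint copies of $H$, and for each $i$ let $u_i,v_i\in V(H_i)$ be the two distinct non-adjacent vertices of $H_i$. Let $x$ be a new vertex, and for each $1\le i\le m$ add a path of length $k$ (that is, with $k$ edges) with endpoints $x$ and $u_i$, whose $k-1$ internal vertices are new and distinct for different $i$. Let $G$ be the resulting graph, let $N$ be its number of vertices, and let $\lambda_1\ge\cdots\ge\lambda_N$ be the eigenvalues of its adjacency matrix. Then $$\alpha_{2k+2}(G)=\alpha_{2k+3}(G)=m,$$ and for each $\ell\in\{2k+2,2k+3\}$ one has $$\alpha_\ell(G)=\left|\{i\in\{1,\dots,N\}:\lambda_i^\ell\ge w_\ell(G)\}\right|.$$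
   Context: Graphs are finite, undirected, simple and loopless. For an integer $\ell\ge 1$, $\alpha_\ell(G)$ is the maximum size of a set of vertices of $G$ that are pairwise at distance greater than $\ell$. With $A$ the adjacency matrix of $G$, $w_\ell(G)=\min_i (A^\ell)_{ii}$ is the minimum, over all vertices $i$ of $G$, of the number of closed walks of length $\ell$ starting at $i$. *)

(* Defs.v *)
From mathcomp Require Import all_boot all_order all_algebra.
From mathcomp Require Import complex.

Set Implicit Arguments.
Unset Strict Implicit.
Unset Printing Implicit Defensive.

Import Order.TTheory GRing.Theory Num.Theory.
Local Open Scope ring_scope.

Record sgraph := SGraph {
  vertex :> finType;
  adj : rel vertex;
  adj_sym : symmetric adj;
  adj_irr : irreflexive adj }.

Section Distance.
Variable G : sgraph.
Implicit Types x y : G.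

Definition walk (k : nat) x y : bool :=
  [exists p : k.-tuple G, path (@adj G) x p && (last x p == y)].

(* [None] is the infinite distance; a shortest walk has fewer than #|G| edges,
   so the search is exhaustive when y is reachable from x. *)
Definition gdist x y : option nat :=
  if connect (@adj G) x y
  then Some (find (fun k => walk k x y) (iota 0 #|G|)) else None.

Definition dist_gt (l : nat) x y : bool :=
  if gdist x y is Some d then (l < d)%N else true.

Definition dist_indep (l : nat) (S : {set G}) : bool :=
  [forall x in S, forall y in S, (x != y) ==> dist_gt l x y].

Definition alpha (l : nat) : nat :=
  \max_(S : {set G} | dist_indep l S) #|S|.

End Distance.

Section Spectrum.
Variable R : rcfType.

Definition adjmx (G : sgraph) : 'M[R]_#|G| :=
  \matrix_(i, j) (adj (enum_val i) (enum_val j))%:R.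

(* The least diagonal entry of A ^ l.  The minimum is seeded with the maximum of
   the same nonnegative family, so the seed does not affect the value (for a
   graph with at least one vertex). *)
Definition min_closed_walks (l : nat) (G : sgraph) : R :=
  \big[Num.min/ \big[Num.max/0]_(i < #|G|) (adjmx G ^+ l) i i]_(i < #|G|)
    (adjmx G ^+ l) i i.

Definition is_spectrum n (A : 'M[R]_n) (s : n.-tuple R) : bool :=
  sorted >=%R s && (char_poly A == \prod_(x <- s) ('X - x%:P)).

Lemma symmx_spectrum n (A : 'M[R]_n) : A^T = A -> exists s, is_spectrum A s.
Proof.
move=> Asym; pose f : {rmorphism R -> complex R} := real_complex R.
pose B := map_mx f A.
have Bsym : B \is symmetricmx.
  by apply/is_hermitianmxP; rewrite expr0 scale1r map_mx_id //; apply/matrixP => i j; rewrite !mxE -[in LHS]Asym mxE.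
have Breal : B \is a mxOver Num.real.
  apply/mxOverP => i j; rewrite mxE.
  by rewrite realE /f /= !lecE /= eqxx /= !le_total.
have Bherm := realsym_hermsym Bsym Breal.
have Bspec := orthomx_spectralP (symmetric_normalmx Bsym Breal).
have dreal := hermitian_spectral_diag_real Bherm.
set P := spectralmx B in Bspec; set d := spectral_diag B in Bspec dreal.
pose s := [tuple complex.Re (d 0 i) | i < n].
have dE i : d 0 i = f (complex.Re (d 0 i)).
  move/mxOverP: dreal => /(_ 0 i); case: (d 0 i) => a b.
  by rewrite realE !lecE /= => /orP[] /andP[/eqP b0 _]; [rewrite b0|rewrite -b0].
have Pu : P \in unitmx by exact: spectral_unit.
have charB : char_poly B = \prod_(i < n) ('X - (d 0 i)%:P).
  transitivity (char_poly (diag_mx d)).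
    have PP : map_mx polyC (invmx P) *m map_mx polyC P = 1%:M.
      by rewrite -map_mxM mulVmx // map_mx1.
    have -> : char_poly B = \det (map_mx polyC (invmx P) *m
        (char_poly_mx (diag_mx d)) *m map_mx polyC P).
      rewrite /char_poly /char_poly_mx mulmxBr mulmxBl -!map_mxM -Bspec.
      by congr (\det (_ - _)); rewrite scalar_mxC -mulmxA PP mulmx1.
    by rewrite !det_mulmx mulrC mulrA [_ * \det (map_mx _ (invmx P))]mulrC
      -det_mulmx PP det1 mul1r.
  rewrite char_poly_trig ?diag_mx_is_trig //.
  by apply: eq_bigr => i _; rewrite mxE eqxx.
exists [tuple of sort >=%R s]; rewrite /is_spectrum sort_sorted /=; last first.
  by move=> x y; exact: le_total.
rewrite (perm_big s) ?perm_sort //=; apply/eqP.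
apply: (map_poly_inj f).
rewrite map_char_poly -/B charB big_map big_enum rmorph_prod.
by apply: eq_bigr => i _; rewrite /= rmorphB /= map_polyX map_polyC /= -dE.
Qed.

Lemma adjmx_spectrum (G : sgraph) : exists s, is_spectrum (adjmx G) s.
Proof.
by apply: symmx_spectrum; apply/matrixP => i j; rewrite !mxE adj_sym.
Qed.

(* The eigenvalues with multiplicity, in nonincreasing order; [is_spectrum]
   determines the tuple uniquely. *)
Definition eigenvalues (G : sgraph) : #|G|.-tuple R :=
  xchoose (adjmx_spectrum G).

Lemma eigenvaluesP (G : sgraph) : is_spectrum (adjmx G) (eigenvalues G).
Proof. exact: xchooseP. Qed.

End Spectrum.

Section CompleteGraph.
Variable n : nat.

Definition complete_adj : rel 'I_n := fun a b => a != b.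

Lemma complete_sym : symmetric complete_adj.
Proof. by move=> a b; rewrite /complete_adj eq_sym. Qed.

Lemma complete_irr : irreflexive complete_adj.
Proof. by move=> a; rewrite /complete_adj eqxx. Qed.

Definition complete_graph := SGraph complete_sym complete_irr.

End CompleteGraph.

Section DeleteEdge.
Variables (G : sgraph) (u v : G).

Definition del_edge_adj : rel G :=
  fun a b => adj a b && ([set a; b] != [set u; v]).

Lemma del_edge_sym : symmetric del_edge_adj.
Proof. by move=> a b; rewrite /del_edge_adj adj_sym setUC. Qed.

Lemma del_edge_irr : irreflexive del_edge_adj.
Proof. by move=> a; rewrite /del_edge_adj adj_irr. Qed.

Definition del_edge := SGraph del_edge_sym del_edge_irr.

End DeleteEdge.

(* m disjoint copies of H, the root u of each one being joined to a common new
   vertex by a path with k edges (meaningful for 0 < k).  [None] is the common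
   vertex, [Some (i, inl j)] the internal vertex number j.+1 of the i-th path
   (counted from the common vertex), and [Some (i, inr a)] the vertex a of the
   i-th copy. *)
Section AttachCopies.
Variables (k m : nat) (H : sgraph) (u : H).

Definition attach_vertex : finType := option ('I_m * ('I_k.-1 + H)).

Definition path_vertex (i : 'I_m) (j : nat) : attach_vertex :=
  if j is j'.+1 then
    if insub j' is Some t then Some (i, inl t) else Some (i, inr u)
  else None.

Definition path_step (a b : attach_vertex) : bool :=
  [exists i : 'I_m, exists j : 'I_k,
    (a == path_vertex i j) && (b == path_vertex i j.+1)].

Definition copy_adj (a b : attach_vertex) : bool :=
  match a, b with
  | Some (i, inr s), Some (j, inr t) => (i == j) && adj s t
  | _, _ => false
  end.

Definition attach_adj : rel attach_vertex :=
  fun a b => [|| copy_adj a b, path_step a b | path_step b a].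

Lemma attach_sym : symmetric attach_adj.
Proof.
move=> a b; rewrite /attach_adj [path_step b a || _]orbC; congr orb.
by case: a b => [[i [s|s]]|] [[j [t|t]]|] //=; rewrite eq_sym adj_sym.
Qed.

Lemma attach_irr : irreflexive attach_adj.
Proof.
move=> a; rewrite /attach_adj orbb.
have -> : copy_adj a a = false.
  by case: a => [[i [s|s]]|] //=; rewrite adj_irr andbF.
rewrite orFb; apply/negbTE/negP => /existsP [i /existsP [j]].
case: j => [[|j] jk] /= /andP[/eqP -> /eqP].
  by case: insubP.
have jk1 : (j < k.-1)%N by move: jk; case: (k).
rewrite insubT; case: insubP => [t _ tE|_] // [/(congr1 val)] /=.
by rewrite tE => /n_Sn.
Qed.

Definition attach_copies := SGraph attach_sym attach_irr.

End AttachCopies.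

(* Main.v *)
Require Import Defs.
From mathcomp Require Import all_boot all_order all_algebra.
From mathcomp Require Import complex zify ring lra.

(** The vertices [v_i] are pairwise at distance [2k + 4], whereas all vertices
    of a branch, as well as the center [x], lie within [k + 1] of [u_i]; this
    gives [alpha = m].

    The [v_i] also give [m <= #{i | w <= lambda_i ^ l}]: no walk of length [l]
    joins two of them, so [A ^ l] restricted to them is diagonal with entries at
    least [w].  For the converse, on the vectors whose sum over each copy of [H]
    vanishes (codimension [m]), a copy contributes at most [0] to the form of
    [A], the star at [x] at most [sqrt m] and the remaining path edges at most
    [2], so that at most [m] eigenvalues exceed [c = sqrt m + 4].  On all
    vectors a copy contributes at least [-2], so that none is below [- c].  On
    the other hand every vertex has a walk of length [k] into some copy, and
    every vertex of a copy has at least [n - 2] closed walks of each of the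
    lengths [2] and [3], so [w >= n - 2 > c ^ l]. *)

Set Implicit Arguments.
Unset Strict Implicit.
Unset Printing Implicit Defensive.

Import Order.TTheory GRing.Theory Num.Theory.
Local Open Scope ring_scope.

(** * Counting eigenvalues of a symmetric matrix by its quadratic form *)

Lemma symmx_exp (R : rcfType) N (A : 'M[R]_N) l :
  A^T = A -> (A ^+ l)^T = A ^+ l.
Proof.
move=> Asym; elim: l => [|l IH]; first by rewrite expr0 trmx1.
by rewrite [in LHS]exprS -mulmxE trmx_mul IH Asym exprSr.
Qed.

Lemma char_poly_similar (F : fieldType) N (P D : 'M[F]_N) :
  P \in unitmx -> char_poly (invmx P *m D *m P) = char_poly D.
Proof.
move=> Pu; set Q := map_mx polyC (invmx P).
have QP : Q *m map_mx polyC P = 1%:M by rewrite -map_mxM mulVmx // map_mx1.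
rewrite /char_poly; have -> : char_poly_mx (invmx P *m D *m P) =
    Q *m char_poly_mx D *m map_mx polyC P.
  rewrite /char_poly_mx mulmxBr mulmxBl -!map_mxM; congr (_ - _).
  by rewrite scalar_mxC -mulmxA QP mulmx1.
by rewrite !det_mulmx mulrAC -det_mulmx QP det1 mul1r.
Qed.

Lemma conj_diag_exp (F : fieldType) N (P : 'M[F]_N) (d : 'rV[F]_N) l :
  P \in unitmx ->
  (invmx P *m diag_mx d *m P) ^+ l =
  invmx P *m diag_mx (\row_i d 0 i ^+ l) *m P.
Proof.
move=> Pu; elim: l => [|l IH].
  have -> : \row_i d 0 i ^+ 0 = const_mx 1.
    by apply/rowP => i; rewrite !mxE expr0.
  by rewrite expr0 diag_const_mx mulmx1 mulVmx.
rewrite [in LHS]exprS IH -mulmxE !mulmxA mulmxK //.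
rewrite -[_ *m diag_mx d *m _]mulmxA mulmx_diag; congr (_ *m diag_mx _ *m _).
by apply/rowP => i; rewrite !mxE exprS.
Qed.

Lemma map_mx_exp (F K : fieldType) (f : {rmorphism F -> K}) N (A : 'M[F]_N) l :
  map_mx f (A ^+ l) = map_mx f A ^+ l.
Proof.
elim: l => [|l IH]; first by rewrite !expr0 map_mx1.
by rewrite !exprS -!mulmxE map_mxM IH.
Qed.

Section ComplexForm.
(* [C] stands for [R[i]], and [re], [im] for its coordinates. *)
Variables (R : rcfType) (C : numClosedFieldType) (f : {rmorphism R -> C}).
Variables re im : C -> R.
Hypothesis fC : forall z, z = f (re z) + 'i * f (im z).
Hypothesis f_real : forall x, f x \is Num.real.

Let conj_f x : (f x)^* = f x.
Proof. exact/CrealP. Qed.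

Lemma re_real_embedding x : x \is Num.real -> x = f (re x).
Proof.
move=> /CrealP; rewrite {1 2}(fC x) rmorphD rmorphM /= !conj_f conjCi => /addrI.
move/eqP; rewrite mulNr eq_sym -addr_eq0 -mulr2n mulrn_eq0 /= => /eqP x0.
by rewrite {1}(fC x) x0 addr0.
Qed.

Lemma sqr_norm_rect a b : `|f a + 'i * f b| ^+ 2 = f (a ^+ 2 + b ^+ 2).
Proof.
rewrite normCK !rmorphD !rmorphXn !rmorphM /= !conj_f conjCi.
have := sqrCi C; set i := 'i => ii; ring: ii.
Qed.

(** The cross terms are ['i] times [b S a^T - a S b^T], which vanishes because [S] is symmetric. A
    complex vector thus splits into two real ones, to which bounds over [R] apply. *)
Lemma hermitian_form_symmx N (S : 'M[R]_N) (a b : 'rV[R]_N) :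
  S^T = S -> let x := map_mx f a + 'i *: map_mx f b in
  (x *m map_mx f S *m (map_mx Num.conj x)^T) 0 0 =
  f ((a *m S *m a^T) 0 0 + (b *m S *m b^T) 0 0).
Proof.
move=> Ssym /=.
have conjf (c : 'rV[R]_N) : map_mx Num.conj (map_mx f c) = map_mx f c.
  by apply/matrixP => i j; rewrite !mxE /= conj_f.
rewrite map_mxD map_mxZ !conjf /= conjCi linearD /= linearZ /=.
rewrite mulmxDl mulmxDr !mulmxDl -!scalemxAl -!scalemxAr !map_trmx -!map_mxM.
have -> : b *m S *m a^T = a *m S *m b^T.
  have t11 (X : 'M[R]_1) : X^T = X by rewrite [X]mx11_scalar tr_scalar_mx.
  by rewrite -[LHS]t11 !trmx_mul trmxK Ssym mulmxA.
move: (a *m S *m a^T) (b *m S *m b^T) (a *m S *m b^T) => X Y Z.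
by rewrite !mxE rmorphD /= mulrA mulrN -expr2 sqrCi opprK mul1r; ring.
Qed.

(** A single unitary [P] diagonalizes all powers of [A] at once, so the form of [A ^+ l] and the
    norm ([l = 0]) can be compared in the same coordinates. Comparing characteristic polynomials
    identifies the diagonal with [s] up to order. *)
Lemma symmx_spectral_exp N (A : 'M[R]_N) (s : N.-tuple R) :
  A^T = A -> is_spectrum A s ->
  exists P : 'M[C]_N, exists e : 'I_N -> R,
  [/\ P \is unitarymx, perm_eq [seq e i | i <- enum 'I_N] s &
      forall l, map_mx f (A ^+ l) =
        invmx P *m diag_mx (\row_i f (e i ^+ l)) *m P].
Proof.
move=> Asym /andP[_ /eqP charA].
pose B := map_mx f A.
have Breal : B \is a mxOver Num.real.
  by apply/mxOverP => i j; rewrite mxE.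
have Bsym : B \is symmetricmx.
  apply/is_hermitianmxP; rewrite expr0 scale1r map_mx_id //.
  by apply/matrixP => i j; rewrite !mxE -[in LHS]Asym mxE.
have dreal := hermitian_spectral_diag_real (realsym_hermsym Bsym Breal).
have BE := orthomx_spectralP (symmetric_normalmx Bsym Breal).
move: dreal BE (spectral_unitarymx B).
move: (spectralmx B) (spectral_diag B) => P d dreal BE Pu.
have Punit := unitarymx_unit Pu.
pose e i := re (d 0 i).
have dE i : d 0 i = f (e i).
  by apply: re_real_embedding; move/mxOverP: dreal.
exists P, e; split; [exact: Pu | | move=> l].
  apply: prod_XsubC_eq; apply: (map_poly_inj f).
  rewrite -charA map_char_poly -/B BE.
  rewrite char_poly_similar // char_poly_trig ?diag_mx_is_trig // rmorph_prod /=.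
  rewrite big_map big_enum; apply: eq_bigr => i _.
  by rewrite rmorphB /= map_polyX map_polyC /= mxE eqxx -dE.
rewrite map_mx_exp -/B BE conj_diag_exp //; congr (_ *m diag_mx _ *m _).
by apply/rowP => i; rewrite !mxE dE rmorphXn.
Qed.

(** If more than [\rank Q] eigenvalues satisfied the strict inequality, the span of their
    eigenvectors would meet the kernel of [Q] in some [x != 0]. As [Q] is real, the real and
    imaginary parts of [x] lie in that kernel too, and the assumed bound contradicts the strict
    inequality. The factor [a] is a sign: [1] serves bounds from above, [-1] bounds from below. *)
Lemma card_spectrum_exp_gt_embedded N p (A : 'M[R]_N) (s : N.-tuple R)
    (Q : 'M[R]_(N, p)) (a c : R) (l : nat) :
  A^T = A -> is_spectrum A s ->
  (forall x : 'rV_N, x *m Q = 0 ->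
     a * (x *m A ^+ l *m x^T) 0 0 <= c * (x *m x^T) 0 0) ->
  (#|[set i | (c < a * tnth s i ^+ l)%R]| <= \rank Q)%N.
Proof.
move=> Asym As boundQ.
have [P [e [Pu es AlE]]] := symmx_spectral_exp Asym As.
pose I := [set i | c < a * e i ^+ l].
have -> : #|[set i | c < a * tnth s i ^+ l]| = #|I|.
  pose q y := c < a * y ^+ l.
  rewrite /I !cardsE !cardE /enum_mem !size_filter.
  transitivity (count q s).
    by rewrite -[in RHS](map_tnth_enum s) [RHS]count_map enumT; apply: eq_count.
  by rewrite -(seq.permP es) [LHS]count_map enumT; apply: eq_count.
rewrite leqNgt; apply/negP => rankQ.
(* The rows of [S *m P] are the eigenvectors indexed by [I]; after multiplication by [Q] their rank
   is below [#|I|], so some combination [z] of them is killed. *)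
pose S : 'M[C]_(#|I|, N) := rowsub (enum_val : 'I_#|I| -> 'I_N) 1%:M.
have /rowV0Pn[z zker z0] : kermx (S *m P *m map_mx f Q) != 0.
  rewrite kermx_eq0 /row_free ltn_eqF //.
  by rewrite (leq_ltn_trans (mxrankM_maxr _ _)) ?mxrank_map.
move/sub_kermxP: zker; rewrite !mulmxA.
set y := z *m S => yPQ.
have yI i : i \notin I -> y 0 i = 0.
  move=> iI; rewrite mxE big1 // => j _; rewrite !mxE.
  by case: eqP => [E|_]; rewrite ?mulr0 //; rewrite -E enum_valP in iI.
have y0 : y != 0.
  apply: contra z0 => /eqP y0; apply/eqP/rowP => j; rewrite mxE.
  have := congr1 (fun t : 'rV_N => t 0 (enum_val j)) y0; rewrite !mxE => <-.
  rewrite (bigD1 j) //= big1 ?addr0 => [|h hj]; rewrite !mxE ?eqxx ?mulr1 //.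
  by rewrite (inj_eq enum_val_inj) (negPf hj) mulr0.
clearbody y; pose x := y *m P.
pose xr := map_mx (re) x; pose xi := map_mx (im) x.
have xE : x = map_mx f xr + 'i *: map_mx f xi by apply/rowP => j; rewrite !mxE -fC.
have [xrQ xiQ] : xr *m Q = 0 /\ xi *m Q = 0.
  suff xQ j : (xr *m Q) 0 j = 0 /\ (xi *m Q) 0 j = 0.
    by split; apply/rowP => j; rewrite [RHS]mxE; case: (xQ j).
  have := congr1 (fun t : 'rV_p => t 0 j) yPQ; rewrite [RHS]mxE -/x xE.
  rewrite mulmxDl -scalemxAl -!map_mxM !mxE => eq0.
  set a' := (X in f X + _) in eq0; set b' := (X in _ + 'i * f X) in eq0.
  have : `|f a' + 'i * f b'| ^+ 2 = 0 by rewrite eq0 normr0 expr0n.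
  move/eqP; rewrite sqr_norm_rect fmorph_eq0 paddr_eq0 ?sqr_ge0 // !sqrf_eq0.
  by case/andP => /eqP a0 /eqP b0; split.
pose w i := re (y 0 i) ^+ 2 + im (y 0 i) ^+ 2.
have wE i : f (w i) = `|y 0 i| ^+ 2 by rewrite -sqr_norm_rect -fC.
(* The exponent [l] gives the form to be bounded, the exponent [0] the squared norm. *)
have formE j : (xr *m A ^+ j *m xr^T) 0 0 + (xi *m A ^+ j *m xi^T) 0 0 =
    \sum_i e i ^+ j * w i.
  apply: (fmorph_inj f).
  rewrite -hermitian_form_symmx ?symmx_exp // -xE AlE /x.
  rewrite map_mxM trmx_mul !mulmxA mulmxK ?unitarymx_unit // map_trmx.
  rewrite -[_ *m P *m _]mulmxA (unitarymxP Pu) mulmx1.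
  rewrite mul_mx_diag !mxE rmorph_sum; apply: eq_bigr => i _ /=.
  rewrite !mxE mulrAC -normCK -wE.
  by rewrite mulrC -rmorphM.
have: \sum_i (a * e i ^+ l - c) * w i <= 0.
  have -> : \sum_i (a * e i ^+ l - c) * w i =
      a * (\sum_i e i ^+ l * w i) - c * (\sum_i e i ^+ 0 * w i).
    rewrite !mulr_sumr -sumrB; apply: eq_bigr => i _; ring.
  rewrite -!formE expr0 !mulmx1; have := boundQ _ xrQ; have := boundQ _ xiQ; lra.
have w0 i : 0 <= w i by rewrite addr_ge0 ?sqr_ge0.
rewrite leNgt => /negP; apply.
have /rV0Pn[i yi0] := y0.
have wi i' : 0 <= (a * e i' ^+ l - c) * w i'.
  have [iI|/yI yi'] := boolP (i' \in I); last first.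
    suff -> : w i' = 0 by rewrite mulr0.
    by apply: (fmorph_inj f); rewrite wE yi' normr0 expr0n [RHS]rmorph0.
  by rewrite mulr_ge0 ?w0 // subr_ge0 ltW //; rewrite inE in iI.
rewrite (bigD1 i) //= ltr_pwDl ?sumr_ge0 //.
have iI : i \in I by apply: contraR yi0 => /yI ->.
rewrite mulr_gt0 ?subr_gt0 //; first by rewrite inE in iI.
rewrite lt0r w0 andbT; apply: contra yi0 => /eqP wi0.
by rewrite -normr_eq0 -sqrf_eq0 -wE wi0 rmorph0 /=.
Qed.
End ComplexForm.

Lemma card_spectrum_exp_gt (R : rcfType) N p (A : 'M[R]_N) (s : N.-tuple R)
    (Q : 'M[R]_(N, p)) (a c : R) (l : nat) :
  A^T = A -> is_spectrum A s ->
  (forall x : 'rV_N, x *m Q = 0 ->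
     a * (x *m A ^+ l *m x^T) 0 0 <= c * (x *m x^T) 0 0) ->
  (#|[set i | (c < a * tnth s i ^+ l)%R]| <= \rank Q)%N.
Proof.
apply: (@card_spectrum_exp_gt_embedded R (complex R) (real_complex R)
  (@complex.Re R) (@complex.Im R)) => [z|x].
  by rewrite -complexiE -complexE.
by rewrite realE !lecE /= eqxx /= le_total.
Qed.

(** On the span of the [m] unit vectors at the [v i], the form of [A ^+ l] is diagonal and at least
    [w] times the squared norm. This span has codimension [N - m], so at most [N - m] eigenvalues
    satisfy [lambda ^+ l < w]. *)
Lemma inertia_bound (R : rcfType) N m (A : 'M[R]_N) (s : N.-tuple R)
    (v : 'I_m -> 'I_N) (w : R) (l : nat) :
  A^T = A -> is_spectrum A s -> injective v ->
  (forall i j, i != j -> (A ^+ l) (v i) (v j) = 0) ->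
  (forall i, w <= (A ^+ l) (v i) (v i)) ->
  (m <= #|[set i | (w <= tnth s i ^+ l)%R]|)%N.
Proof.
move=> Asym As v_inj off diag.
pose U : 'M[R]_(m, N) := rowsub v 1%:M.
have UBU (B : 'M[R]_N) : U *m B *m U^T = \matrix_(i, j) B (v i) (v j).
  rewrite mul_rowsub_mx mul1mx; apply/matrixP => i j; rewrite !mxE.
  rewrite (bigD1 (v j)) //= big1 ?addr0 => [|h hj]; rewrite !mxE ?eqxx ?mulr1 //.
  by rewrite eq_sym (negPf hj) mulr0.
have UU : U *m U^T = 1%:M.
  rewrite -[U in U *m _]mulmx1 UBU; apply/matrixP => i j.
  by rewrite !mxE (inj_eq v_inj).
have rankU : \rank U = m.
  by apply/eqP; apply/row_freeP; exists U^T.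
(* The row space of [U] is presented as the kernel of [cokermx U], whose rank is [N - m]. *)
have bound (x : 'rV_N) : x *m cokermx U = 0 ->
    -1 * (x *m A ^+ l *m x^T) 0 0 <= - w * (x *m x^T) 0 0.
  move/eqP; rewrite -submxE => /submxP[z ->].
  rewrite trmx_mul !mulmxA -[z *m U *m _]mulmxA -[z *m (U *m _) *m _]mulmxA UBU.
  rewrite -[z *m U *m _]mulmxA UU mulmx1.
  rewrite mulN1r mulNr lerN2 !mxE mulr_sumr; apply: ler_sum => i _.
  rewrite !mxE (bigD1 i) //= big1 ?addr0 => [|h hi]; last first.
    by rewrite !mxE off ?mulr0.
  by rewrite !mxE; have := ler_wpM2l (sqr_ge0 (z 0 i)) (diag i); lra.
have := card_spectrum_exp_gt Asym As bound.
rewrite mxrank_coker rankU => le1.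
have le_mN : (m <= N)%N by have := rank_leq_col U; rewrite rankU.
rewrite -(leq_add2r (N - m)) subnKC // -{1}(card_ord N) -(cardsC [set i | w <= tnth s i ^+ l]).
rewrite leq_add2l; apply: leq_trans le1; apply/subset_leq_card/subsetP => i.
by rewrite !inE mulN1r ltrN2 ltNge.
Qed.

(** * Walks and powers of the adjacency matrix *)

Lemma walkS (G : sgraph) t (a b c : G) :
  adj a b -> walk t b c -> walk t.+1 a c.
Proof.
move=> ab /existsP[p /andP[pb pc]]; apply/existsP; exists [tuple of b :: p].
by rewrite /= ab pb.
Qed.

Lemma walk0 (G : sgraph) (a : G) : walk 0 a a.
Proof. by apply/existsP; exists [tuple]; rewrite /=. Qed.

Lemma walkSP (G : sgraph) t (a c : G) :
  reflect (exists2 b, adj a b & walk t b c) (walk t.+1 a c).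
Proof.
apply: (iffP idP) => [/existsP[p]|[b]]; last exact: walkS.
case/tupleP: p => b p /= /andP[/andP[ab pb] pc]; exists b => //.
by apply/existsP; exists p; rewrite pb pc.
Qed.

Lemma walk_cat (G : sgraph) t1 t2 (a b c : G) :
  walk t1 a b -> walk t2 b c -> walk (t1 + t2) a c.
Proof.
elim: t1 a => [|t1 IH] a.
  by case/existsP => p; rewrite tuple0 /= => /eqP <-.
by case/walkSP => a' aa' a'b bc; rewrite addSn; apply/walkSP; exists a'; rewrite ?IH.
Qed.

Lemma walk1 (G : sgraph) (a b : G) : adj a b -> walk 1 a b.
Proof. by move=> ab; apply: walkS ab (walk0 b). Qed.

Lemma walk_sym (G : sgraph) t (a b : G) : walk t a b -> walk t b a.
Proof.
elim: t a => [|t IH] a; first by case/existsP => p; rewrite tuple0 /= => /eqP <-; exact: walk0.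
case/walkSP => c ac /IH cb; rewrite -addn1; apply: walk_cat cb _.
by apply: walk1; rewrite adj_sym.
Qed.

Lemma walk_connect (G : sgraph) t (a b : G) : walk t a b -> connect (@adj G) a b.
Proof.
by case/existsP => p /andP[pa /eqP <-]; apply/connectP; exists p.
Qed.

(** Shortening a path to a duplicate-free one brings its length below [#|G|], so the search in
    [gdist] succeeds between connected vertices and returns the least length of a walk. *)
Lemma dist_gtP (G : sgraph) l (a b : G) :
  reflect (forall t, (t <= l)%N -> ~~ walk t a b) (dist_gt l a b).
Proof.
rewrite /dist_gt /gdist; case: ifP => [ab|ab]; last first.
  apply: ReflectT => t _; apply: contraFN ab; exact: walk_connect.
set s := iota 0 _; set W := fun t => walk t a b.
have findW : W (find W s).
  have [p pa] := connectP ab; case/shortenP: pa => q qa qu _ qb.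
  have szq : (size q < #|G|)%N.
    by rewrite -[(size q).+1]/(size (a :: q)) -(card_uniqP qu) max_card.
  have hasW : has W s.
    apply/hasP; exists (size q); first by rewrite mem_iota.
    by apply/existsP; exists (in_tuple q); rewrite qa qb /=.
  have := nth_find 0 hasW; rewrite nth_iota // ; last first.
    by rewrite -[X in (_ < X)%N](size_iota 0) -has_find.
apply: (iffP idP) => [lt_l t le_tl|noW].
  apply/negP => Wt.
  have tG : (t < #|G|)%N.
    apply: leq_ltn_trans le_tl (leq_trans lt_l _).
    by rewrite -[X in (_ <= X)%N](size_iota 0) find_size.
  have := @before_find _ 0 W s t (leq_ltn_trans le_tl lt_l).
  by rewrite nth_iota // add0n /W Wt.
by rewrite ltnNge; apply: contraL findW => /noW.
Qed.

(** Used to bound distances from below by a potential [phi]. *)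
Lemma walk_lipschitz (G : sgraph) (phi : G -> nat) :
  (forall a b, adj a b -> phi b <= (phi a).+1)%N ->
  forall t a b, walk t a b -> (phi b <= phi a + t)%N.
Proof.
move=> phi1; elim=> [|t IH] a b.
  by case/existsP => p; rewrite tuple0 /= => /eqP <-; rewrite addn0.
by case/walkSP => c /phi1 ac /IH cb; lia.
Qed.

Lemma sum2_delta (R : pzRingType) (T : finType) (x y : T) (F : T -> T -> R) :
  \sum_a \sum_b ((a == x) && (b == y))%:R * F a b = F x y.
Proof.
rewrite (bigD1 x) //= (bigD1 y) //= !eqxx mul1r !big1 ?addr0 //.
  by move=> a /negPf ax; rewrite big1 // => b _; rewrite ax mul0r.
by move=> b /negPf bx; rewrite bx mul0r.
Qed.

Section AdjacencyPowers.
Variables (R : rcfType) (G : sgraph).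

Definition walks (l : nat) (a b : G) : R :=
  (adjmx R G ^+ l) (enum_rank a) (enum_rank b).

Lemma sum_enum_val (F : 'I_#|G| -> R) : \sum_i F i = \sum_(a : G) F (enum_rank a).
Proof.
rewrite (reindex_onto (@enum_rank G) enum_val) /= => [|i _].
  by apply: eq_bigl => a; rewrite enum_rankK eqxx.
exact: enum_valK.
Qed.

Lemma walks0 (a b : G) : walks 0 a b = (a == b)%:R.
Proof. by rewrite /walks expr0 mxE (inj_eq enum_rank_inj). Qed.

Lemma walksD s t (a c : G) :
  walks (s + t) a c = \sum_b walks s a b * walks t b c.
Proof. by rewrite /walks exprD -mulmxE mxE sum_enum_val. Qed.

Lemma walksS l (a c : G) :
  walks l.+1 a c = \sum_b (adj a b)%:R * walks l b c.
Proof.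
rewrite -add1n walksD; apply: eq_bigr => b _.
by rewrite [walks 1 _ _]mxE !enum_rankK.
Qed.

Lemma walks_ge0 l (a b : G) : 0 <= walks l a b.
Proof.
elim: l a b => [|l IH] a b; first by rewrite walks0.
by rewrite walksS sumr_ge0 // => c _; rewrite mulr_ge0.
Qed.

Lemma walks_cat_ge s t (a b c : G) :
  walks s a b * walks t b c <= walks (s + t) a c.
Proof.
rewrite walksD (bigD1 b) //= lerDl sumr_ge0 // => d _.
by rewrite mulr_ge0 ?walks_ge0.
Qed.

Lemma walks_ge1 l (a b : G) : walk l a b -> 1 <= walks l a b.
Proof.
elim: l a => [|l IH] a.
  by case/existsP => p; rewrite tuple0 /= walks0 => ->.
case/walkSP => c ac /IH cb; rewrite walksS (bigD1 c) //= ac mul1r.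
by rewrite ler_wpDr // sumr_ge0 // => d _; rewrite mulr_ge0 ?walks_ge0.
Qed.

Lemma walks_eq0 l (a b : G) : ~~ walk l a b -> walks l a b = 0.
Proof.
elim: l a => [|l IH] a nw.
  rewrite walks0; case: eqP nw => // ->; by rewrite walk0.
rewrite walksS big1 // => c _; have [ac|] := boolP (adj a c); last by rewrite mul0r.
by rewrite IH ?mulr0 //; apply: contra nw; exact: walkS.
Qed.

Lemma walks_card_ge (D : {set G}) l (a : G) :
  {in D, forall b, adj a b && walk l b a} -> #|D|%:R <= walks l.+1 a a.
Proof.
move=> Dw; rewrite walksS (bigID (mem D)) /= -sum1_card natr_sum.
rewrite ler_wpDr ?sumr_ge0 // => [b _|]; first by rewrite mulr_ge0 ?walks_ge0.
by apply: ler_sum => b /Dw /andP[-> /walks_ge1]; rewrite mul1r.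
Qed.

Lemma min_closed_walks_ge l w (a0 : G) :
  (forall a, w <= walks l a a) -> w <= min_closed_walks R l G.
Proof.
move=> le_w.
have lew i : w <= (adjmx R G ^+ l) i i by have := le_w (enum_val i); rewrite /walks enum_valK.
(* The seed of the minimum must also be at least [w]: being the largest diagonal entry, it dominates
   the one at [a0]. *)
apply: le_bigmin => //; apply: le_trans (lew (enum_rank a0)) _.
exact: (le_bigmax _ (fun i => (adjmx R G ^+ l) i i)).
Qed.

Lemma min_closed_walks_le l (a : G) : min_closed_walks R l G <= walks l a a.
Proof. exact: (bigmin_le _ _ (fun i => (adjmx R G ^+ l) i i)). Qed.

(** Go from [a] to [b], follow a closed walk at [b], and return by the reversed first walk. *)
Lemma walks_return_ge k l (a b : G) :
  walk k a b -> walks l b b <= walks (k + (l + k)) a a.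
Proof.
move=> kab; apply: le_trans (walks_cat_ge k (l + k) a b a).
apply: le_trans (_ : 1 * (walks l b b * 1) <= _); first by rewrite mul1r mulr1.
rewrite ler_pM ?mulr_ge0 ?walks_ge0 ?walks_ge1 //.
apply: le_trans (walks_cat_ge l k b b a).
by rewrite ler_wpM2l ?walks_ge0 // walks_ge1 // walk_sym.
Qed.

Lemma trmx_adjmx : (adjmx R G)^T = adjmx R G.
Proof. by apply/matrixP => i j; rewrite !mxE adj_sym. Qed.

Definition adj_form (g : G -> R) : R := \sum_a \sum_b (adj a b)%:R * g a * g b.

Lemma adjmx_form (x : 'rV[R]_#|G|) :
  (x *m adjmx R G *m x^T) 0 0 = adj_form (fun a => x 0 (enum_rank a)).
Proof.
rewrite /adj_form -mulmxA mxE sum_enum_val; apply: eq_bigr => a _.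
rewrite mxE mulr_sumr sum_enum_val; apply: eq_bigr => b _.
by rewrite !mxE !enum_rankK; ring.
Qed.

Lemma sqnorm_row (x : 'rV[R]_#|G|) :
  (x *m x^T) 0 0 = \sum_a x 0 (enum_rank a) ^+ 2.
Proof. by rewrite mxE sum_enum_val; apply: eq_bigr => a _; rewrite mxE. Qed.

End AdjacencyPowers.

(** * Copies of a graph attached to a center by paths *)

Section AttachCopies.
Variables (k m : nat) (H : sgraph) (u : H).
Hypothesis k_gt0 : (0 < k)%N.
Local Notation G := (attach_copies k m u).
Local Notation pv := (path_vertex k u).
Local Notation copy i s := (Some (i, inr s) : attach_vertex k m H).

Definition branch (a : attach_vertex k m H) : option 'I_m := omap fst a.

(** When [e] is the distance to [u] in [H], this is the distance to the center. With [e] constantly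
    [0] it still tells the positions on a path apart. *)
Definition depth (e : H -> nat) (a : attach_vertex k m H) : nat :=
  match a with
  | None => 0
  | Some (_, inl t) => t.+1
  | Some (_, inr s) => k + e s
  end.

Lemma path_vertex_inl (i : 'I_m) (t : 'I_k.-1) : pv i t.+1 = Some (i, inl t).
Proof. by rewrite /path_vertex valK. Qed.

Lemma path_vertex_end (i : 'I_m) : pv i k = copy i u.
Proof. by case: k k_gt0 => // k' _; rewrite /path_vertex insubF // ltnn. Qed.

Lemma path_vertexP (i : 'I_m) j : (j <= k)%N ->
  [\/ j = 0%N /\ pv i j = None,
      exists2 t : 'I_k.-1, j = t.+1 & pv i j = Some (i, inl t) |
      j = k /\ pv i j = copy i u].
Proof.
case: j => [|j] jk; first by constructor 1.
have [lt_jk|le_kj] := ltnP j k.-1.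
  by constructor 2; exists (Ordinal lt_jk); rewrite // -path_vertex_inl.
have -> : j.+1 = k by lia.
by constructor 3; rewrite path_vertex_end.
Qed.

Lemma depth_path_vertex (e : H -> nat) (i : 'I_m) j :
  e u = 0%N -> (j <= k)%N -> depth e (pv i j) = j.
Proof.
move=> eu /(path_vertexP i)[[-> ->] //|[t -> ->] //|[-> ->]].
by rewrite /= eu addn0.
Qed.

Lemma branch_path_vertex (i : 'I_m) j : (j < k)%N -> branch (pv i j.+1) = Some i.
Proof. by move/(path_vertexP i)=> [[]|[t _ ->]|[_ ->]]. Qed.

Lemma path_stepP (a b : G) :
  reflect (exists i j, [/\ (j < k)%N, a = pv i j & b = pv i j.+1])
    (path_step u a b).
Proof.
apply: (iffP existsP) => [[i /existsP[j /andP[/eqP aE /eqP bE]]]|].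
  by exists i, j.
by case=> i [j [jk -> ->]]; exists i; apply/existsP; exists (Ordinal jk); rewrite !eqxx.
Qed.

Lemma adj_copy (i : 'I_m) (s t : H) : adj s t -> @adj G (copy i s) (copy i t).
Proof. by move=> st; rewrite /= /attach_adj /= eqxx st. Qed.

Lemma adj_path_vertex (i : 'I_m) j : (j < k)%N -> @adj G (pv i j) (pv i j.+1).
Proof.
move=> jk; apply/orP; right; apply/orP; left.
by apply/path_stepP; exists i, j.
Qed.

Lemma attach_adjP (a b : G) : adj a b ->
  (exists i s t, [/\ adj s t, a = copy i s & b = copy i t]) \/
  (exists i j, (j < k)%N /\
    (a = pv i j /\ b = pv i j.+1 \/ a = pv i j.+1 /\ b = pv i j)).
Proof.
rewrite /= /attach_adj => /or3P[|/path_stepP|/path_stepP].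
- case: a b => [[i [s|s]]|] [[j [t|t]]|] //= /andP[/eqP <- st].
  by left; exists i, s, t.
- by case=> i [j [jk -> ->]]; right; exists i, j; split; [|left].
- by case=> i [j [jk -> ->]]; right; exists i, j; split; [|right].
Qed.

Lemma walk_copy (i : 'I_m) l (s t : H) :
  walk l s t -> @walk G l (copy i s) (copy i t).
Proof.
elim: l s => [|l IH] s.
  by case/existsP => p; rewrite tuple0 /= => /eqP <-; exact: walk0.
by case/walkSP => r sr /IH rt; apply/walkSP; exists (copy i r) => //; exact: adj_copy.
Qed.

Lemma walk_path_vertex (i : 'I_m) j d : (j + d <= k)%N ->
  @walk G d (pv i j) (pv i (j + d)).
Proof.
elim: d j => [|d IH] j jd; first by rewrite addn0; exact: walk0.
apply/walkSP; exists (pv i j.+1); first by apply: adj_path_vertex; lia.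
by rewrite addnS -addSn IH //; lia.
Qed.

Lemma attach_vertexP (a : G) :
  [\/ a = None,
      exists i j, (j < k)%N /\ a = pv i j.+1 | exists i s, a = copy i s].
Proof.
case: a => [[i [t|s]]|].
- constructor 2; exists i, t; rewrite path_vertex_inl; split=> //.
  by have := ltn_ord t; lia.
- by constructor 3; exists i, s.
- by constructor 1.
Qed.

(* Unfolds branch [i] and the rest of [G] onto a line whose origin is the far
   end of branch [i]: leaving that branch lowers [depth], and then raises it. *)
Definition unfolded_depth (e : H -> nat) d (i : 'I_m) (a : attach_vertex k m H) :=
  if branch a == Some i then (d - depth e a)%N else (d + depth e a)%N.

(** Both formulas are 1-Lipschitz along edges inside a branch, and at the center, the only passage
    between branches, both give [d]. *)
Lemma unfolded_depth_lipschitz (e : H -> nat) d (i : 'I_m) :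
  e u = 0%N -> (forall s t : H, adj s t -> e t <= (e s).+1)%N ->
  (forall a b : G, adj a b ->
     unfolded_depth e d i b <= (unfolded_depth e d i a).+1)%N.
Proof.
move=> eu e1 a b; rewrite /unfolded_depth => /attach_adjP[[i' [s [t [st -> ->]]]]|].
  rewrite /= /branch /=; have := e1 _ _ st; rewrite adj_sym in st.
  by have := e1 _ _ st; case: eqP => _; lia.
case=> i' [j [jk]].
have bj : (branch (pv i' j) == Some i) = (0 < j)%N && (i' == i).
  by case: j jk => //= j jk; rewrite branch_path_vertex // ltnW.
have dj : depth e (pv i' j) = j by rewrite depth_path_vertex // ltnW.
have dj1 : depth e (pv i' j.+1) = j.+1 by rewrite depth_path_vertex.
case=> -[-> ->]; rewrite bj branch_path_vertex // (inj_eq Some_inj) dj dj1;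
  by case: eqP => _; case: posnP => ?; rewrite /=; lia.
Qed.

(** Two vertices assigned to the same branch are joined through its [u] by a walk of length at most
    [r + r <= l], so an independent set has at most one vertex per branch. *)
Lemma alpha_attach_le l r : (0 < m)%N -> (k <= r)%N -> (r + r <= l)%N ->
  (forall s : H, exists2 t, (t <= r)%N & walk t s u) -> (alpha G l <= m)%N.
Proof.
move=> m_gt0 kr rl wH; apply/bigmax_leqP => S /forall_inP indep.
(* The center is put in branch [0]; any branch would do, as it has a walk of length [k <= r] to
   every copy of [u]. *)
pose br (a : G) := odflt (Ordinal m_gt0) (branch a).
have walk_end a : exists2 t, (t <= r)%N & @walk G t a (copy (br a) u).
  case: (attach_vertexP a) => [->|[i [j [jk ->]]]|[i [s ->]]].
  - exists k => //; rewrite -path_vertex_end.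
    exact: (@walk_path_vertex _ 0 k).
  - rewrite /br branch_path_vertex // -path_vertex_end.
    exists (k - j.+1)%N; first by lia.
    by have := @walk_path_vertex i j.+1 (k - j.+1); rewrite subnKC // => /(_ (leqnn k)).
  - by have [t tr st] := wH s; exists t => //; exact: walk_copy.
have br_inj : {in S &, injective br}.
  move=> a b aS bS brab; apply: contraTeq isT => ab.
  have /forall_inP/(_ b bS)/implyP/(_ ab)/dist_gtP := indep a aS.
  have [s sr wa] := walk_end a; have [t tr wb] := walk_end b.
  move=> /(_ (s + t)%N) noW; apply: contraNN (noW _) => [_|]; last by lia.
  by apply: walk_cat wa _; rewrite brab walk_sym.
by rewrite -(card_in_imset br_inj) -[X in (_ <= X)%N](card_ord m) max_card.
Qed.

(** The length is exactly [k]: from position [j] of a path, [k - j] steps lead to [u], and the other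
    [j] steps are spent inside the copy, where no vertex is isolated. *)
Lemma walk_to_copy (a : G) : (0 < m)%N -> (forall s : H, exists t, adj s t) ->
  exists i s, @walk G k a (copy i s).
Proof.
move=> m_gt0 nbr.
have walkH d (s : H) : exists t, walk d s t.
  elim: d s => [|d IH] s; first by exists s; exact: walk0.
  by have [r sr] := nbr s; have [t rt] := IH r; exists t; exact: walkS sr rt.
have main i j : (j <= k)%N -> exists s, @walk G k (pv i j) (copy i s).
  move=> jk; have [s us] := walkH j u; exists s.
  rewrite -[X in walk X](subnK jk); apply: walk_cat (walk_copy _ us).
  have := @walk_path_vertex i j (k - j).
  by rewrite -path_vertex_end subnKC // => /(_ (leqnn k)).
case: (attach_vertexP a) => [->|[i [j [jk ->]]]|[i [s ->]]].
- by exists (Ordinal m_gt0); apply: (main _ 0%N).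
- by exists i; apply: (main _ j.+1).
- by have [t st] := walkH k s; exists i, t; exact: walk_copy.
Qed.

(** * The quadratic form of the attached graph *)

Section Form.
Variable R : rcfType.

Lemma sum_attach (F : attach_vertex k m H -> R) :
  \sum_a F a = F None + \sum_i (\sum_t F (Some (i, inl t)) +
                                 \sum_s F (Some (i, inr s))).
Proof.
rewrite (bigD1 None) //=; congr (_ + _).
rewrite (reindex_omap Some id) => [|[a|]] //=.
under eq_bigl => p do rewrite eqxx.
transitivity (\sum_(p : 'I_m * ('I_k.-1 + H)) F (Some (p.1, p.2))).
  by apply: eq_bigr => -[].
rewrite -(pair_bigA _ (fun i c => F (Some (i, c)))) /=.
by apply: eq_bigr => i _; rewrite big_sumType.
Qed.

(** At most one term is nonzero: the depth of [a] determines [j], and the branch of [b] determines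
    [i]. The branch of [a] would not do, since [a] may be the center. *)
Lemma natr_path_step (a b : G) : (path_step u a b)%:R =
  \sum_i \sum_(j < k) ((a == pv i j) && (b == pv i j.+1))%:R :> R.
Proof.
have [/path_stepP[i [j [jk -> ->]]]|noS] := boolP (path_step u a b); last first.
  rewrite big1 // => i _; rewrite big1 // => j _; apply/eqP.
  rewrite pnatr_eq0 eqb0; apply: contra noS => /andP[/eqP aE /eqP bE].
  by apply/path_stepP; exists i, j.
have pv_inj i' (j' : 'I_k) : pv i j = pv i' j' -> j = j'.
  by move/(congr1 (depth (fun=> 0%N))); rewrite !depth_path_vertex // ltnW.
rewrite (bigD1 i) //= (bigD1 (Ordinal jk)) //= !eqxx big1 ?addr0 => [|j' jj'].
  rewrite big1 ?addr0 // => i' ii'; rewrite big1 // => j' _.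
  case: eqP => //= /pv_inj <-; case: eqP => // /(congr1 branch).
  by rewrite !branch_path_vertex // => -[E]; rewrite E eqxx in ii'.
case: eqP => //= /pv_inj jE; case: eqP => // _.
by rewrite -val_eqE /= jE eqxx in jj'.
Qed.

(** The three cases exclude each other: with [e] constantly [0], copy edges have both ends at depth
    [k], while a path step raises the depth by one from a value below [k]. *)
Lemma natr_attach_adj (a b : G) : (adj a b)%:R =
  (copy_adj a b)%:R + (path_step u a b)%:R + (path_step u b a)%:R :> R.
Proof.
pose d := depth (fun=> 0%N).
have stepd (a' b' : G) : path_step u a' b' -> d b' = (d a').+1 /\ (d a' < k)%N.
  by case/path_stepP => i [j [jk -> ->]]; rewrite /d !depth_path_vertex // ltnW.
have copyd (a' b' : G) : copy_adj a' b' -> d a' = k /\ d b' = k.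
  by case: a' b' => [[i [s|s]]|] [[j [t|t]]|] //=; rewrite addn0.
rewrite /= /attach_adj.
have [/copyd ab|_] := boolP (copy_adj a b);
have [/stepd ab1|_] := boolP (path_step u a b);
have [/stepd ba1|_] := boolP (path_step u b a); rewrite /= ?addr0 ?add0r //; lia.
Qed.

Lemma attach_form (g : G -> R) : adj_form g =
  \sum_i (adj_form (fun s : H => g (copy i s)) +
          2 * \sum_(j < k) g (pv i j) * g (pv i j.+1)).
Proof.
pose E := \sum_i \sum_(j < k) g (pv i j) * g (pv i j.+1).
have stepE : \sum_(a : G) \sum_(b : G) (path_step u a b)%:R * (g a * g b) = E.
  under eq_bigr => a _ do under eq_bigr => b _ do rewrite natr_path_step mulr_suml.
  under eq_bigr => a _ do rewrite exchange_big /=.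
  rewrite exchange_big; apply: eq_bigr => i _.
  under eq_bigr => a _ do under eq_bigr => b _ do rewrite mulr_suml.
  under eq_bigr => a _ do rewrite exchange_big /=.
  rewrite exchange_big; apply: eq_bigr => j _ /=.
  exact: (sum2_delta _ _ (fun a b => g a * g b)).
have stepE' : \sum_(a : G) \sum_(b : G) (path_step u b a)%:R * (g a * g b) = E.
  rewrite -stepE exchange_big; apply: eq_bigr => a _; apply: eq_bigr => b _.
  by rewrite [g b * _]mulrC.
have copyE : \sum_(a : G) \sum_(b : G) (copy_adj a b)%:R * (g a * g b) =
    \sum_i adj_form (fun s : H => g (copy i s)).
  rewrite sum_attach big1 ?add0r => [|b _]; last by rewrite mul0r.
  apply: eq_bigr => i _.
  rewrite big1 ?add0r => [|t _]; last by rewrite big1 // => b _; rewrite mul0r.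
  apply: eq_bigr => s _.
  rewrite sum_attach /= mul0r add0r (bigD1 i) //= big1 ?add0r => [|t _]; last first.
    by rewrite mul0r.
  rewrite [X in _ + X]big1 ?addr0 => [|i' ii'].
    by apply: eq_bigr => t _; rewrite eqxx /= mulrA.
  rewrite !big1 ?addr0 // => t _; rewrite ?mul0r //.
  by rewrite eq_sym (negPf ii') mul0r.
rewrite big_split /= -copyE -mulr_sumr -/E mulr2n mulrDl mul1r -{1}stepE -stepE'.
rewrite -!big_split; apply: eq_bigr => a _.
rewrite -!big_split; apply: eq_bigr => b _ /=.
by rewrite natr_attach_adj; ring.
Qed.

(** Induction on the path, [e] being a sign. The first edge is split with weights [1 / r] and [r],
    the others evenly; the slack [- h d.+1 ^+ 2] pays for the near end of the next edge. *)
Lemma path_form_le (h : nat -> R) (r e : R) d : 0 < r -> e ^+ 2 = 1 ->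
  e * (2 * \sum_(j < d.+1) h j * h j.+1) <=
  h 0%N ^+ 2 / r + (r + 2) * (\sum_(j < d.+1) h j.+1 ^+ 2) - h d.+1 ^+ 2.
Proof.
move=> r_gt0 e2; have r0 : r != 0 by rewrite gt_eqF.
elim: d => [|d IH].
  rewrite !big_ord1.
  have : 0 <= (h 0%N - e * r * h 1%N) ^+ 2 / r by rewrite mulr_ge0 ?sqr_ge0 ?invr_ge0 ?ltW.
  have -> : (h 0%N - e * r * h 1%N) ^+ 2 / r =
     h 0%N ^+ 2 / r - e * 2 * h 0%N * h 1%N + e ^+ 2 * r * h 1%N ^+ 2 by field.
  have := sqr_ge0 (h 1%N); rewrite e2; lra.
rewrite big_ord_recr [X in _ <= _ + _ * X - _]big_ord_recr /=.
have := sqr_ge0 (h d.+1 - e * h d.+2); have := sqr_ge0 (h d.+2).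
have -> : (h d.+1 - e * h d.+2) ^+ 2 =
  h d.+1 ^+ 2 - 2 * e * h d.+1 * h d.+2 + e ^+ 2 * h d.+2 ^+ 2 by ring.
have : 0 <= r * h d.+2 ^+ 2 by rewrite mulr_ge0 ?sqr_ge0 ?ltW.
move: IH; rewrite e2; lra.
Qed.

(* [2 |g x g y| <= g x ^ 2 / r + r g y ^ 2] at the edges of the center, with
   [r = sqrt m], and [2 |g x g y| <= g x ^ 2 + g y ^ 2] at the other path edges. *)
Lemma attach_form_le (g : G -> R) (r e : R) :
  0 < r -> r ^+ 2 = m%:R -> e ^+ 2 = 1 ->
  (forall i, e * adj_form (fun s : H => g (copy i s)) <=
             2 * \sum_s g (copy i s) ^+ 2) ->
  e * adj_form g <= (r + 4) * \sum_a g a ^+ 2.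
Proof.
move=> r_gt0 r2 e2 formH.
rewrite attach_form sum_attach mulr_sumr.
have le_i i : e * (adj_form (fun s : H => g (copy i s)) +
    2 * \sum_(j < k) g (pv i j) * g (pv i j.+1)) <=
  g None ^+ 2 / r + (r + 4) * (\sum_t g (Some (i, inl t)) ^+ 2 +
                              \sum_s g (copy i s) ^+ 2).
  have le_path := path_form_le (fun j => g (pv i j)) k.-1 r_gt0 e2.
  rewrite prednK // in le_path.
  have sumk : \sum_(j < k) g (pv i j.+1) ^+ 2 =
      \sum_t g (Some (i, inl t)) ^+ 2 + g (copy i u) ^+ 2.
    have pend : pv i k.-1.+1 = copy i u by rewrite prednK // path_vertex_end.
    transitivity (\sum_(j < k.-1.+1) g (pv i j.+1) ^+ 2); first by rewrite prednK.
    rewrite big_ord_recr; congr (_ + _); last by rewrite -pend.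
    by apply: eq_bigr => t _; rewrite path_vertex_inl.
  rewrite sumk path_vertex_end in le_path.
  (* The vertex [u] is charged at most [r + 2] by its path and [2] by its copy, whence the constant
     [r + 4]. *)
  have uS : g (copy i u) ^+ 2 <= \sum_s g (copy i s) ^+ 2.
    by rewrite (bigD1 u) //= lerDl sumr_ge0 // => s _; rewrite sqr_ge0.
  have T0 : 0 <= \sum_t g (Some (i, inl t)) ^+ 2.
    by rewrite sumr_ge0 // => s _; rewrite sqr_ge0.
  have ruS := ler_wpM2l (ltW r_gt0) uS.
  have := formH i; move: le_path uS ruS T0 (sqr_ge0 (g (copy i u))) => /=; lra.
apply: le_trans (ler_sum _ (fun i _ => le_i i)) _.
(* The center is charged [1 / r] by each of the [m = r ^+ 2] branches, that is [r] in all. *)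
rewrite big_split /= sumr_const card_ord -[_ *+ m]mulr_natl -r2 -mulr_sumr mulrDr lerD2r.
have -> : r ^+ 2 * (g None ^+ 2 / r) = r * g None ^+ 2 by field; rewrite gt_eqF.
by rewrite ler_wpM2r ?sqr_ge0 // lerDl.
Qed.

End Form.
End AttachCopies.

(** * A complete graph minus an edge *)

Section CompleteMinusEdge.
Variables (n : nat) (u v : 'I_n).
Hypothesis u_neq_v : u != v.
Local Notation H := (@del_edge (complete_graph n) u v).

Lemma adj_complete_minus_edge (a b : H) : adj a b =
  (a != b) && ~~ ((a == u) && (b == v) || (a == v) && (b == u)).
Proof.
rewrite /= /del_edge_adj /= /complete_adj; congr (_ && ~~ _).
apply/eqP/orP => [E|[/andP[/eqP -> /eqP ->]|/andP[/eqP -> /eqP ->]] //]; last exact: setUC.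
have : u \in [set a; b] by rewrite E !inE eqxx.
have : v \in [set a; b] by rewrite E !inE eqxx orbT.
rewrite !inE [u == a]eq_sym [u == b]eq_sym [v == a]eq_sym [v == b]eq_sym.
case/orP => /eqP vE /orP[] /eqP uE; rewrite ?vE ?uE ?eqxx ?orbT; [|by right|by left|];
  by move: u_neq_v; rewrite -vE -uE eqxx.
Qed.

Lemma adj_common (w a : H) : w != u -> w != v -> adj w a = (w != a).
Proof.
by move=> /negPf wu /negPf wv; rewrite adj_complete_minus_edge wu wv andbT.
Qed.

Lemma ex_common_neighbor (a b : H) : (4 < n)%N ->
  exists w : H, adj a w && adj w b.
Proof.
move=> n_gt4; pose A : {set 'I_n} := [set a; b; u; v].
have ltA : (#|A| < #|'I_n|)%N.
  rewrite card_ord; apply: leq_ltn_trans n_gt4.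
  by rewrite /A -!setUA !cardsU1 cards1; do 3 case: (_ \notin _).
have /existsP[w] : [exists w, w \notin A].
  rewrite -negb_forall; apply: contraL ltA => /forallP allA.
  by rewrite -leqNgt; apply/subset_leq_card/subsetP.
rewrite !inE !negb_or -!andbA => /and4P[wa wb wu wv].
by exists w; rewrite [adj a w]adj_sym !adj_common ?wa.
Qed.

Lemma ex_neighborhood (a : H) :
  exists2 D : {set H}, (n - 2 <= #|D|)%N & {in D, forall b, adj a b}.
Proof.
(* Besides [a] itself, [p] is the only possible non-neighbor of [a]: the other end of the removed
   edge if [a] is one of its ends. *)
pose p : 'I_n := if a == u then v else u.
exists (~: [set (a : 'I_n); p]) => [|b].
  rewrite -{1}(card_ord n) -(cardsC [set (a : 'I_n); p]) leq_subLR leq_add2r.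
  by rewrite cards2; case: eqP.
rewrite !inE negb_or => /andP[ba]; rewrite /p adj_complete_minus_edge [a == b]eq_sym ba.
case: (a =P u) => [-> bv|au bu]; first by rewrite (negPf bv) (negPf u_neq_v).
by rewrite (negPf bu) andbF.
Qed.

Lemma walk_to_end (a : H) : (4 < n)%N -> exists2 t, (t <= 2)%N & walk t a u.
Proof.
move=> n_gt4; have [w /andP[aw wu]] := ex_common_neighbor a u n_gt4.
by exists 2%N => //; apply: walkS aw (walk1 wu).
Qed.

(** The distance to [u] in [H], as soon as [n > 2]. *)
Definition end_depth (a : H) : nat := if a == u then 0 else if a == v then 2 else 1.

Lemma end_depth_lipschitz (a b : H) : adj a b -> (end_depth b <= (end_depth a).+1)%N.
Proof.
rewrite adj_complete_minus_edge /end_depth.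
by case: (a == u); case: (b == u); case: (a == v); case: (b == v); rewrite //= andbF.
Qed.

(** The adjacency matrix is the all-ones matrix minus the identity and minus the two entries of the
    removed edge. The only large term is thus the square of the sum, which is nonnegative and
    vanishes on vectors of sum [0]. *)
Lemma complete_minus_edge_form (R : rcfType) (g : H -> R) :
  adj_form g = (\sum_a g a) ^+ 2 - \sum_a g a ^+ 2 - 2 * g u * g v.
Proof.
have sq : \sum_a g a ^+ 2 = \sum_a \sum_b (a == b)%:R * (g a * g b).
  apply: eq_bigr => a _; rewrite (bigD1 a) //= eqxx mul1r big1 ?addr0 // => b ba.
  by rewrite eq_sym (negPf ba) mul0r.
have -> : 2 * g u * g v = \sum_a \sum_b ((a == u) && (b == v))%:R * (g a * g b) +
   \sum_a \sum_b ((a == v) && (b == u))%:R * (g a * g b).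
  by rewrite !(sum2_delta _ _ (fun a b => g a * g b)); ring.
rewrite sq expr2 mulr_suml -!big_split -!sumrB; apply: eq_bigr => a _.
rewrite mulr_sumr -!big_split -!sumrB; apply: eq_bigr => b _.
rewrite adj_complete_minus_edge /=.
case: (a =P b) => [->|_] /=.
  case: (b =P u) => [->|_]; last by case: (b =P v) => _ /=; ring.
  by rewrite (negPf u_neq_v) /=; ring.
case: (a =P u) => [->|_]; last by case: (a =P v); case: (b =P u) => _ _ /=; ring.
by rewrite (negPf u_neq_v) /=; case: (b =P v) => _ /=; ring.
Qed.

End CompleteMinusEdge.

(** * Attached cliques *)

Section CliquesAttached.
Variables (R : rcfType) (k m n : nat) (u v : 'I_n).
Hypotheses (k_gt0 : (0 < k)%N) (u_neq_v : u != v).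
Local Notation H := (@del_edge (complete_graph n) u v).
Local Notation G := (@attach_copies k m H u).
Local Notation copy i s := (Some (i, inr (s : H)) : G).

Lemma far_walk t (i j : 'I_m) :
  i != j -> @walk G t (copy i v) (copy j v) -> (2 * k + 4 <= t)%N.
Proof.
move=> ij; have end0 : @end_depth n u v u = 0%N by rewrite /end_depth eqxx.
(* The depth of each copy of [v] is [k + 2]; with this origin the potential is [0] at the copy [i]
   and [2 * k + 4] at the copy [j]. *)
have lip := unfolded_depth_lipschitz k_gt0 (k + 2) i end0
  (@end_depth_lipschitz n u v u_neq_v).
move=> /(walk_lipschitz lip).
rewrite /unfolded_depth /branch /= eqxx (inj_eq Some_inj) eq_sym (negPf ij).
by rewrite /end_depth eq_sym (negPf u_neq_v) eqxx; lia.
Qed.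

Hypotheses (m_gt0 : (0 < m)%N) (n_gt4 : (4 < n)%N).

(** The upper bound, with radius [k + 1] around the copies of [u], needs [2 * k + 2 <= l];
    independence of the copies of [v] needs [l < 2 * k + 4]. *)
Lemma alpha_cliques l : (2 * k + 2 <= l <= 2 * k + 3)%N -> alpha G l = m.
Proof.
move=> /andP[l_ge l_le]; apply/eqP; rewrite eqn_leq; apply/andP; split.
  apply: (@alpha_attach_le k m H u k_gt0 l k.+1) => //; first by lia.
  move=> s; have [t t2 st] := walk_to_end u_neq_v s n_gt4.
  by exists t => //; lia.
pose S : {set G} := [set copy i v | i in 'I_m].
have cardS : #|S| = m by rewrite card_imset ?card_ord // => i j [].
rewrite -[X in (X <= _)%N]cardS; apply: leq_bigmax_cond.
apply/forall_inP => _ /imsetP[i _ ->]; apply/forall_inP => _ /imsetP[j _ ->].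
apply/implyP => ij; apply/dist_gtP => t tl; apply/negP => /far_walk t_ge.
have : (2 * k + 4 <= t)%N by apply: t_ge; apply: contra ij => /eqP ->.
by lia.
Qed.

(** Each of the at least [n - 2] neighbors [t] of [s] starts a closed walk: return directly for
    length [2], through a common neighbor of [t] and [s] for length [3]. *)
Lemma walks_copy_ge l (i : 'I_m) (s : H) : l \in [:: 2%N; 3%N] ->
  (n - 2)%:R <= walks R l (copy i s) (copy i s).
Proof.
move=> l23; have [D cardD adjD] := ex_neighborhood u_neq_v s.
have copy_inj : injective (fun t => copy i t) by move=> ? ? [].
apply: le_trans (_ : #|[set copy i t | t in D]|%:R <= _).
  by rewrite ler_nat card_imset.
have {l23} [l' -> l'12] : exists2 l', l = l'.+1 & (l' == 1%N) || (l' == 2%N).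
  by move: l23; rewrite !inE => /orP[] /eqP ->; [exists 1%N|exists 2%N].
apply: walks_card_ge => _ /imsetP[t /adjD st ->].
rewrite adj_copy //=; apply: walk_copy.
case/orP: l'12 => /eqP ->; first by apply: walk1; rewrite adj_sym.
have [w /andP[tw ws]] := ex_common_neighbor u_neq_v t s n_gt4.
exact: walkS tw (walk1 ws).
Qed.

Lemma min_closed_walks_cliques_ge l : (2 * k + 2 <= l <= 2 * k + 3)%N ->
  (n - 2)%:R <= min_closed_walks R l G.
Proof.
move=> lk; apply: (min_closed_walks_ge (None : G)) => a.
have nbr (s : H) : exists t, adj s t.
  by have [w /andP[sw _]] := ex_common_neighbor u_neq_v s s n_gt4; exists w.
have [i [s aw]] := walk_to_copy k_gt0 a m_gt0 nbr.
(* The [2 * k] steps to the copy and back leave a closed walk of length [2] or [3] inside it. *)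
have -> : l = (k + ((l - 2 * k) + k))%N by lia.
apply: le_trans (walks_return_ge R _ aw); apply: walks_copy_ge.
rewrite !inE; lia.
Qed.

Lemma card_eigenvalues_gt (r : R) (s : #|G|.-tuple R) :
  0 < r -> r ^+ 2 = m%:R -> is_spectrum (adjmx R G) s ->
  (#|[set i | (r + 4 < tnth s i)%R]| <= m)%N.
Proof.
move=> r_gt0 r2 specs.
(* The columns are the indicators of the copies, so [x *m Q = 0] makes the sum of [x] over each copy
   vanish, at the cost of rank at most [m]. *)
pose Q : 'M[R]_(#|G|, m) := \matrix_(a, i)
  if enum_val a is Some (j, inr _) then (j == i)%:R else 0.
have bound (x : 'rV_#|G|) : x *m Q = 0 ->
    1 * (x *m adjmx R G ^+ 1 *m x^T) 0 0 <= (r + 4) * (x *m x^T) 0 0.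
  move=> xQ; rewrite expr1 adjmx_form sqnorm_row.
  apply: (@attach_form_le k m H u k_gt0 R _ r 1) => // [|i].
    by rewrite expr1n.
  set g := fun s : H => _.
  have sum0 : \sum_s g s = 0.
    have := congr1 (fun y : 'rV_m => y 0 i) xQ; rewrite !mxE sum_enum_val sum_attach.
    rewrite mxE enum_rankK mulr0 add0r (bigD1 i) //= big1 ?add0r => [|t _]; last first.
      by rewrite mxE enum_rankK mulr0.
    rewrite [X in _ + X]big1 ?addr0 => [eq0|j ji].
      by rewrite -[RHS]eq0; apply: eq_bigr => t _; rewrite mxE enum_rankK eqxx mulr1.
    rewrite !big1 ?addr0 // => t _; rewrite mxE enum_rankK ?mulr0 //.
    by rewrite (negPf ji) mulr0.
  rewrite (complete_minus_edge_form u_neq_v) sum0 expr0n mul1r.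
  have gsum : 0 <= \sum_s g s ^+ 2 by rewrite sumr_ge0 // => t _; rewrite sqr_ge0.
  have guv : g u ^+ 2 + g v ^+ 2 <= \sum_s g s ^+ 2.
    rewrite (bigD1 u) //= (bigD1 v) 1?eq_sym //= addrA lerDl sumr_ge0 // => t _.
    by rewrite sqr_ge0.
  (* With sum [0], the form of the copy is at most [g u ^+ 2 + g v ^+ 2] minus the squared norm of
     [g], hence nonpositive. *)
  have := sqr_ge0 (g u + g v); rewrite /=; nra.
have := card_spectrum_exp_gt (trmx_adjmx R G) specs bound.
under eq_finset => i do rewrite mul1r expr1.
by move=> /leq_trans; apply; exact: rank_leq_col.
Qed.

Lemma eigenvalues_ge (r : R) (s : #|G|.-tuple R) i :
  0 < r -> r ^+ 2 = m%:R -> is_spectrum (adjmx R G) s ->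
  - (r + 4) <= tnth s i.
Proof.
move=> r_gt0 r2 specs.
(* The zero column imposes no constraint and has rank [0], so the count of eigenvalues below
   [- (r + 4)] will be [0]. *)
have bound (x : 'rV_#|G|) : x *m (0 : 'cV_#|G|) = 0 ->
    -1 * (x *m adjmx R G ^+ 1 *m x^T) 0 0 <= (r + 4) * (x *m x^T) 0 0.
  move=> _; rewrite expr1 adjmx_form sqnorm_row.
  apply: (@attach_form_le k m H u k_gt0 R _ r (-1)) => // [|j].
    by rewrite sqrrN expr1n.
  set g := fun s : H => _.
  rewrite (complete_minus_edge_form u_neq_v) mulN1r.
  have guv : g u ^+ 2 + g v ^+ 2 <= \sum_s g s ^+ 2.
    rewrite (bigD1 u) //= (bigD1 v) 1?eq_sym //= addrA lerDl sumr_ge0 // => t _.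
    by rewrite sqr_ge0.
  (* The negated form is at most the squared norm plus [2 * g u * g v], hence at most twice the
     squared norm. *)
  have := sqr_ge0 (g u - g v); have := sqr_ge0 (\sum_s g s); nra.
have := card_spectrum_exp_gt (trmx_adjmx R G) specs bound.
rewrite mxrank0 leqn0 cards_eq0 => /eqP/setP/(_ i).
by rewrite !inE mulN1r expr1 ltrNr => /negbT; rewrite -leNgt.
Qed.

End CliquesAttached.

Theorem mainTheorem2 (R : rcfType) (k m n : nat) (u v : 'I_n)
    (k_gt0 : (0 < k)%N) (m_gt0 : (0 < m)%N) (u_neq_v : u != v)
    (n_large : (Num.sqrt m%:R + 4) ^+ (2 * k + 3) < n%:R - 2 :> R) :
  let H := @del_edge (complete_graph n) u v in
  let G := @attach_copies k m H u in
  [/\ alpha G (2 * k + 2) = m,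
      alpha G (2 * k + 3) = m &
      forall l : nat, l \in [:: (2 * k + 2)%N; (2 * k + 3)%N] ->
        alpha G l =
        #|[set i : 'I_#|G| |
            min_closed_walks R l G <= tnth (eigenvalues R G) i ^+ l]|].
Proof.
move=> H G; set r : R := Num.sqrt m%:R in n_large.
have r_gt0 : 0 < r by rewrite sqrtr_gt0 ltr0n.
have r2 : r ^+ 2 = m%:R by rewrite sqr_sqrtr ?ler0n.
have c_ge1 : 1 <= r + 4 by lra.
have n_gt4 : (4 < n)%N.
  rewrite -(ltr_nat R); have : r + 4 <= (r + 4) ^+ (2 * k + 3).
    by rewrite -[X in X <= _]expr1 ler_weXn2l // addn3.
  lra.
have alphaE l : (2 * k + 2 <= l <= 2 * k + 3)%N -> alpha G l = m.
  exact: alpha_cliques.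
split; [by apply: alphaE; lia | by apply: alphaE; lia |].
move=> l l_in; have {l_in} l_range : (2 * k + 2 <= l <= 2 * k + 3)%N.
  by move: l_in; rewrite !inE => /orP[] /eqP ->; lia.
rewrite alphaE //; have specs := eigenvaluesP R G.
set s := eigenvalues R G in specs *; set w := min_closed_walks R l G.
have c_lt_w : (r + 4) ^+ l < w.
  apply: le_lt_trans (_ : (r + 4) ^+ (2 * k + 3) < _).
    by rewrite ler_weXn2l //; lia.
  apply: lt_le_trans n_large _.
  have := min_closed_walks_cliques_ge R k_gt0 u_neq_v m_gt0 n_gt4 l_range.
  apply: le_trans.
  by rewrite natrB //; lia.
apply/eqP; rewrite eqn_leq; apply/andP; split.
  pose f (i : 'I_m) := enum_rank (Some (i, inr v) : G).
  apply: (@inertia_bound R _ m (adjmx R G) s f) => //.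
  - exact: trmx_adjmx.
  - by move=> i j /enum_rank_inj [].
  - move=> i j ij; apply: walks_eq0; apply/negP => /(far_walk k_gt0 u_neq_v ij); lia.
  - by move=> i; apply: min_closed_walks_le.
(* An eigenvalue at most [r + 4] has absolute value at most [r + 4] by [eigenvalues_ge], so its
   power [l] stays below [w]. The lower bound matters for [l = 2 * k + 2], which is even. *)
apply: leq_trans (card_eigenvalues_gt k_gt0 u_neq_v r_gt0 r2 specs).
apply/subset_leq_card/subsetP => i; rewrite !inE => w_le.
rewrite ltNge; apply: contraL w_le => s_le; rewrite -ltNge.
apply: le_lt_trans c_lt_w; apply: le_trans (ler_norm _) _; rewrite normrX.
rewrite lerXn2r ?nnegrE ?normr_ge0 ?(le_trans ler01) // ler_norml s_le andbT.
exact: (eigenvalues_ge k_gt0 u_neq_v).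
Qed.
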